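(* Let $1\leq m\leq k\leq s$, $q\geq 0$, and $0\leq \ell\leq s-1$ be integers. The number $|\mathsf{CF}(q,s,k,\ell,m)|$ of naturally ordered chain forests $\mathcal{F}$ of $[s]$ with $k$ blocks and weight $q$ such that $\gamma(\mathcal{F},\ell)=m$ is given by $$|\mathsf{CF}(q,s,k,\ell,m)|=\sum_{i=0}^q(-1)^i\binom{s}{i}\, \Pi^{s-\ell-m}_{-i+1,\,s-1-\ell-i}\; \Pi^{\ell-(k-m)}_{s-\ell-i,\,s-1-i} \binom{k-1+q-i}{k-1}.$$
   Context: $[s]=\{1,\dots,s\}$. An ordered chain forest of $[s]$ is an ordered partition $\mathcal{F}=\mathsf{B}_1\cdots\mathsf{B}_k$ of $[s]$ into nonempty blocks, where each block is itself internally (linearly) ordered; both the order of the blocks and the order inside each block matter. The first element of a block is its leader and the last element is its trailer. An ordered chain forest is naturally ordered if its blocks are ordered increasingly according to their leaders. The weight $\mathsf{wt}(\mathsf{B})$ of a block $\mathsf{B}$ is the number of elements of the block that are less than its leader; the weight of an ordered chain forest is the sum of the weights of its blocks. For $0\le \ell\le s-1$, $$\gamma(\mathcal{F},\ell)=\left|\left\{j\in[k] : \sum_{i=1}^j|\mathsf{B}_i|>\ell\right\}\right|,$$ i.e. writing out all elements of $\mathcal{F}$ in order as a sequence, $\gamma(\mathcal{F},\ell)$ is the number of trailers that appear after the $\ell$-th position. $\mathsf{CF}(q,s,k,\ell,m)$ is the set of naturally ordered chain forests $\mathcal{F}$ of $[s]$ with $k$ blocks, weight $q$, and $\gamma(\mathcal{F},\ell)=m$.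 For integers $a\le b+1$ and $n$, $\Pi^n_{a,b}=\sum_{a\leq i_1<\cdots<i_n\leq b} i_1\cdots i_n$ is the sum of all products of $n$ distinct integers between $a$ and $b$ (inclusive), with $\Pi^0_{a,b}=1$ and $\Pi^n_{a,b}=0$ if $n<0$ or $n>b-a+1$. In particular, for the empty range, $\Pi^0_{a+1,a}=1$ and $\Pi^n_{a+1,a}=0$ for $n\neq 0$. *)

(* Defs.v *)
From mathcomp Require Import all_boot all_order all_algebra.

Set Implicit Arguments.
Unset Strict Implicit.
Unset Printing Implicit Defensive.

Import Order.TTheory GRing.Theory Num.Theory.

Local Open Scope nat_scope.

(* Throughout, [s] = {1, ..., s} is represented by 'I_s = {0, ..., s - 1}: only
   the number of elements and their relative order matter. *)

Definition chain_forest (s : nat) (F : seq (seq 'I_s)) : bool :=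
  all (fun B => B != [::]) F && perm_eq (flatten F) (enum 'I_s).

(* The value on the empty block is irrelevant: blocks are nonempty. *)
Definition leader (s : nat) (B : seq 'I_s) : nat :=
  if B is x :: _ then x else 0.

Definition naturally_ordered (s : nat) (F : seq (seq 'I_s)) : bool :=
  sorted ltn (map (@leader s) F).

Definition block_weight (s : nat) (B : seq 'I_s) : nat :=
  count (fun x : 'I_s => x < leader B) B.

Definition weight (s : nat) (F : seq (seq 'I_s)) : nat :=
  \sum_(B <- F) block_weight B.

Definition gamma (s : nat) (F : seq (seq 'I_s)) (l : nat) : nat :=
  count (fun j => l < \sum_(B <- take j F) size B) (iota 1 (size F)).

(* A chain forest of [s] has at most s blocks, each with at most s elements, so
   the bounded sequences below contain all of them; the bounds only serve to
   make the ambient type finite. *)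
Definition blocks (s : nat) (F : s.-bseq (s.-bseq 'I_s)) : seq (seq 'I_s) :=
  map (@bseqval s 'I_s) F.

Definition CF (q s k l m : nat) : {set s.-bseq (s.-bseq 'I_s)} :=
  [set F | [&& chain_forest (blocks F), naturally_ordered (blocks F),
               size (blocks F) == k, weight (blocks F) == q
             & gamma (blocks F) l == m]].

Local Open Scope ring_scope.

(* The integers between a and b are the a + j with 0 <= j < b - a + 1. The
   exponent n is an integer: for n < 0, as for n > b - a + 1, no set A has
   cardinality n and the sum is 0. *)
Definition Pi (n a b : int) : int :=
  \sum_(A : {set 'I_(absz (Num.max 0 (b - a + 1)))} | #|A|%:Z == n)
    \prod_(j in A) (a + j%:Z).

(* Main.v *)
Require Import Defs.
From mathcomp Require Import all_boot all_order all_algebra.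
From mathcomp Require Import ring zify.

Import Order.TTheory GRing.Theory Num.Theory.

Local Open Scope ring_scope.

(** Write out a naturally ordered chain forest as a word, element by element,
    giving weight [t] to each element below its leader and weight [x_r] to each
    trailer followed by [r] further elements. The total weight of the possible
    continuations only depends on the numbers [a] and [b] of unused elements
    below and above the current leader, and satisfies
      [f(a,b) = a t f(a-1,b) + b f(a,b-1) + x_{a+b} sum_{c<b} f(a+c,b-1-c)],
    with [f(0,0) = x_0]. Put [x_r = (1-t) X_r], let [E] shift the variable [i]
    by one, and let [Phi_n(i) = X_0 prod_{1<=j<=n} (X_j + j - i)]. Then
      [f(a,b) = (1-t) t^a (1 - t E)^b (1 - E)^a Phi_{a+b}] at [i = 0];
    the tail sums of [f] telescope because the [(n+1)]-st difference of the
    polynomial [Phi_n], of degree [n], vanishes. The sum over all forests is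
    therefore [(1 - t E)^s Phi_{s-1}(0)]. With [X_r = U] for [r < s - l] and
    [X_r = V] otherwise, the coefficient of [U^m V^(k-m)] is [(1-t)^k] times the
    generating function of the weight, and dividing by [(1-t)^k] gives the
    formula. *)

(** * Shift operators and the closed form of the state weights *)

(* The value at [i = 0] of [P(E) Phi_n], computed through the identity
   [P(E) i = i P(E) + E P'(E)] of operators. *)
Fixpoint shift_eval (R : comNzRingType) (X : nat -> R) (n : nat) (P : {poly R}) : R :=
  if n is n'.+1 then
    shift_eval R X n' ((X n + n%:R) *: P - 'X * P^`())
  else X 0 * P.[1].

Arguments shift_eval {R} X n P.

Section ShiftEval.
Variables (R : comNzRingType) (X : nat -> R).

Lemma shift_evalD n P Q :
  shift_eval X n (P + Q) = shift_eval X n P + shift_eval X n Q.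
Proof.
elim: n P Q => [|n IH] P Q; first by rewrite /= hornerD mulrDr.
by rewrite [LHS]/= derivD scalerDr mulrDr opprD addrACA IH.
Qed.

Lemma shift_evalZ n c P : shift_eval X n (c *: P) = c * shift_eval X n P.
Proof.
elim: n P => [|n IH] P; first by rewrite /= hornerZ mulrCA.
by rewrite [LHS]/= derivZ scalerA mulrC -scalerA -scalerAr -scalerBr IH.
Qed.

Lemma shift_eval_natl n c P : shift_eval X n (c%:R * P) = c%:R * shift_eval X n P.
Proof. by rewrite mulr_natl -scaler_nat shift_evalZ. Qed.

Lemma shift_eval0 n : shift_eval X n 0 = 0.
Proof. by rewrite -[0 in LHS](scale0r 0) shift_evalZ mul0r. Qed.

Lemma shift_eval_sum n I (r : seq I) (F : I -> {poly R}) :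
  shift_eval X n (\sum_(i <- r) F i) = \sum_(i <- r) shift_eval X n (F i).
Proof.
by elim/big_rec2: _ => [|i y1 y2 _ <-]; rewrite ?shift_eval0 ?shift_evalD.
Qed.

(** Identifies [shift_eval] with the shift operators: ['X^i] is an eigenvector, of eigenvalue [i],
    of ['X] times the derivative, so each step of the recursion contributes one factor of
    [Phi_n(i)]. *)
Lemma shift_evalXn n i :
  shift_eval X n 'X^i = X 0 * \prod_(1 <= j < n.+1) (X j + j%:R - i%:R).
Proof.
elim: n => [|n IH]; first by rewrite /= hornerXn expr1n big_geq.
rewrite big_nat_recr //= mulrA -IH.
rewrite [RHS]mulrC -shift_evalZ; congr shift_eval.
rewrite derivXn scalerBl mulrnAr scaler_nat; congr (_ - _).
case: i {IH} => [|i]; first by rewrite !mulr0n.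
by rewrite -exprS.
Qed.

(** A step of the recursion differentiates once, so it removes at most one factor [1 - 'X]; after
    [n] steps a factor remains, and the final evaluation at 1 kills it. *)
Lemma shift_eval_vanish n Q : shift_eval X n ((1 - 'X) ^+ n.+1 * Q) = 0.
Proof.
elim: n Q => [|n IH] Q.
  by rewrite /= expr1 hornerM hornerD hornerN hornerX hornerC; ring.
rewrite [LHS]/= derivM deriv_exp derivB derivX (derivC 1) /=.
rewrite -mul_polyC.
set c := _%:P; set Q' := Q^`().
rewrite (_ : _ - _ = (1 - 'X) ^+ n.+1 *
  (c * (1 - 'X) * Q + n.+2%:R * 'X * Q - 'X * (1 - 'X) * Q')) ?IH //.
by rewrite -(mulr_natl _ n.+2) [_ ^+ n.+2]exprS; ring.
Qed.

Variable t : R.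

Definition state_weight (a b : nat) : R :=
  (1 - t) * t ^+ a
    * shift_eval X (a + b) ((1 - t *: 'X) ^+ b * (1 - 'X) ^+ a).

Lemma state_weight00 : state_weight 0 0 = (1 - t) * X 0.
Proof. by rewrite /state_weight /= !expr0 !mulr1 hornerC mulr1. Qed.

(** Induction on [b] through [1 - t *: 'X = (1 - t) + t *: (1 - 'X)]: the first summand yields the
    term [c = 0], the second the remaining tail, which starts at [a.+1]. For [b = 0] the second
    summand vanishes by [shift_eval_vanish]. *)
Lemma state_weight_tail a b :
  \sum_(c < b.+1) state_weight (a + c) (b - c)
  = t ^+ a * shift_eval X (a + b) ((1 - t *: 'X) ^+ b.+1 * (1 - 'X) ^+ a).
Proof.
elim: b a => [|b IH] a.
  rewrite big_ord1 /state_weight /= !addn0 mulrAC mulrC; congr (_ * _).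
  rewrite expr1 expr0 mul1r -shift_evalZ.
  rewrite [in RHS](_ : _ * _ = (1 - t) *: (1 - 'X) ^+ a
     + (1 - 'X) ^+ a.+1 * t%:P); last first.
    by rewrite -!mul_polyC exprS rmorphB /=; ring.
  by rewrite shift_evalD shift_eval_vanish addr0.
rewrite [_ ^+ b.+2]exprS big_ord_recl subn0 addn0.
under eq_bigr => c _ do rewrite /= /bump /= add1n addnS -addSn subSS.
rewrite IH /state_weight addSnnS [t ^+ a.+1]exprSr [_ * t ^+ a]mulrC -!mulrA.
rewrite -mulrDr; congr (_ * _); rewrite -!shift_evalZ -shift_evalD; congr shift_eval.
by rewrite -!mul_polyC [_ ^+ a.+1]exprS rmorphB /=; ring.
Qed.

(** Here [c] counts the elements below the first leader of a forest on [s.+1] elements. The tail sum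
    from [a = 0] leaves a pure power of [1 - t *: 'X], to which the binomial theorem applies. *)
Lemma state_weight_total s :
  \sum_(c < s.+1) state_weight c (s - c)
  = \sum_(0 <= i < s.+2)
      'C(s.+1, i)%:R * (- t) ^+ i
        * (X 0 * \prod_(1 <= j < s.+1) (X j + j%:R - i%:R)).
Proof.
rewrite (state_weight_tail 0) expr0 mul1r expr0 mulr1.
rewrite -scaleNr exprDn shift_eval_sum big_mkord; apply: eq_bigr => i _.
rewrite expr1n mul1r exprZn -scaler_nat scalerA shift_evalZ.
by rewrite shift_evalXn.
Qed.

(** The three terms are the choices for the next element: below the leader, above it in the same
    block, or a new leader with [c] of the [b] larger elements below it. A zero coefficient makes
    the truncated [a.-1] and [b.-1] harmless. *)
Lemma state_weightE a b : (0 < a + b)%N ->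
  state_weight a b = a%:R * t * state_weight a.-1 b
    + b%:R * state_weight a b.-1
    + (1 - t) * X (a + b) * \sum_(c < b) state_weight (a + c) (b.-1 - c).
Proof.
move=> ab_gt0; rewrite {1}/state_weight.
have [n Dn] : exists n, (a + b = n.+1)%N by exists (a + b).-1; lia.
rewrite Dn [shift_eval X n.+1 _]/=.
set P := _ * (1 - 'X) ^+ a.
(* Split [n.+1] as [a + b] and use the Leibniz rule: subtracting from [1 - t *: 'X] or [1 - 'X] its
   derivative times ['X] leaves 1, so one power loses a factor in each term. *)
have -> : (X n.+1 + n.+1%:R) *: P - 'X * P^`() = X n.+1 *: P
  + ((b%:R * (1 - t *: 'X) ^+ b.-1 * (1 - 'X) ^+ a)
  + (a%:R * (1 - t *: 'X) ^+ b * (1 - 'X) ^+ a.-1)).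
  rewrite scalerDl -addrA; congr (_ + _).
  have mul_exp_pred (p : {poly R}) c : c%:R * p ^+ c = c%:R * p * p ^+ c.-1.
    by case: c => [|c]; rewrite ?mul0r // exprS mulrA.
  rewrite -Dn -mul_polyC rmorph_nat natrD /P derivM !deriv_exp !derivB derivZ.
  rewrite derivX (derivC 1).
  move: (mul_exp_pred (1 - t *: 'X) b) (mul_exp_pred (1 - 'X) a).
  rewrite -!mul_polyC.
  move: (_ ^+ b) (_ ^+ a) (_ ^+ b.-1) (_ ^+ a.-1) => pb qa pb' qa' Hb Ha.
  have -> : (a%:R + b%:R) * (pb * qa) = a%:R * qa * pb + b%:R * pb * qa by ring.
  by rewrite Ha Hb; ring.
rewrite !shift_evalD shift_evalZ.
rewrite !mulrDr addrC; congr (_ + _); last first.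
  (* For [b = 0] the tail sum is empty, and [P] is [(1 - 'X) ^+ n.+1], which vanishes at level
     [n]. *)
  case: b ab_gt0 Dn @P => [|b] _ Dn P.
    rewrite big_ord0 mulr0 /P expr0 mul1r.
    have -> : (a = n.+1)%N by lia.
    by rewrite -[(1 - 'X) ^+ _]mulr1 shift_eval_vanish !mulr0.
  rewrite state_weight_tail; have -> : (a + b = n)%N by lia.
  by rewrite -/P; ring.
rewrite addrC; congr (_ + _).
  case: a ab_gt0 Dn {P} => [|a] _ Dn.
    by rewrite !mul0r shift_eval0 mulr0.
  rewrite -[a.+1%:R * _ * _]mulrA shift_eval_natl /state_weight /= exprS.
  have -> : (a + b = n)%N by lia.
  ring.
case: b ab_gt0 Dn {P} => [|b] _ Dn.
  by rewrite !mul0r shift_eval0 mulr0.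
rewrite -[b.+1%:R * _ * _]mulrA shift_eval_natl /state_weight /=.
have -> : (a + b = n)%N by lia.
ring.
Qed.

End ShiftEval.

Arguments state_weight {R} X t a b.

Lemma count_lt (T : eqType) (a b : pred T) (A : seq T) z :
  subpred a b -> z \in A -> ~~ a z -> b z -> (count a A < count b A)%N.
Proof.
move=> sub_ab zA naz bz; elim: A zA => //= w A IH; rewrite inE.
case/predU1P => [<-|/IH lt_ab].
  by rewrite (negPf naz) bz add0n add1n ltnS sub_count.
by have := sub_ab w; case: (a w) => [->|_] //; case: (b w); lia.
Qed.

Definition rank {s} (A : seq 'I_s) (z : 'I_s) : nat :=
  count (fun w : 'I_s => (w < z)%N) A.

Definition corank {s} (A : seq 'I_s) (z : 'I_s) : nat :=
  count (fun w : 'I_s => (z < w)%N) A.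

Section Rank.
Variables (s : nat) (A : seq 'I_s).

Lemma rank_lt (y z : 'I_s) : y \in A -> (y < z)%N -> (rank A y < rank A z)%N.
Proof.
move=> yA y_z; apply: (count_lt _ _ _ _ y) => //; last by rewrite ltnn.
by move=> w /= /ltn_trans; apply.
Qed.

Lemma rank_size z : z \in A -> (rank A z < size A)%N.
Proof.
move=> zA; rewrite -[size A]count_predT.
by apply: (count_lt _ _ _ _ z); rewrite ?ltnn.
Qed.

Lemma rank_corank y : y \notin A -> (rank A y + corank A y = size A)%N.
Proof.
move=> yA; rewrite -(count_predC (fun w : 'I_s => (w < y)%N)); congr addn.
apply: eq_in_count => w wA /=; rewrite -leqNgt ltn_neqAle.
by case: eqP => // /val_inj yw; rewrite yw wA in yA.
Qed.

Hypothesis uniqA : uniq A.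

(** Rank is strictly increasing on [A], hence injective, and bounded by [size A]; by pigeonhole it
    takes every value once. Sums over elements thus become sums over ranks. *)
Lemma perm_map_rank : perm_eq (map (rank A) A) (iota 0 (size A)).
Proof.
have uniq_rank : uniq (map (rank A) A).
  rewrite map_inj_in_uniq // => y z yA zA eq_yz; apply: val_inj.
  by case: (ltngtP y z) => // /rank_lt; [move/(_ yA)|move/(_ zA)];
    rewrite eq_yz ltnn.
apply: uniq_perm; rewrite ?iota_uniq //.
have [] // := @uniq_min_size _ _ (iota 0 (size A)) uniq_rank;
  last by rewrite size_map size_iota.
by move=> _ /mapP[z zA ->]; rewrite mem_iota rank_size.
Qed.

Lemma rank_rem y z : z \in A -> rank (rem z A) y = (rank A y - (z < y))%N.
Proof. by move=> zA; rewrite /rank count_rem zA. Qed.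

Lemma corank_rem y z : z \in A -> corank (rem z A) y = (corank A y - (y < z))%N.
Proof. by move=> zA; rewrite /corank count_rem zA. Qed.

Lemma sum_above_rank (R : nmodType) (phi : nat -> R) y : y \notin A ->
  \sum_(z <- A | (y < z)%N) phi (rank A z)
  = \sum_(c < corank A y) phi (rank A y + c)%N.
Proof.
move=> yA.
transitivity (\sum_(z <- A | (rank A y <= rank A z)%N) phi (rank A z)).
  rewrite big_seq_cond [RHS]big_seq_cond; apply: eq_bigl => z.
  case zA: (z \in A) => //=.
  case: (ltngtP y z) => [y_z|z_y|/val_inj yz]; last by rewrite yz zA in yA.
    by rewrite sub_count // => w /= /ltn_trans; apply.
  by rewrite leqNgt rank_lt.
rewrite -(big_map (rank A) (fun c => (rank A y <= c)%N) phi).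
rewrite (perm_big _ perm_map_rank) /= -{1}(subn0 (size A)) -/(index_iota 0 _).
rewrite -(rank_corank y yA).
rewrite -(big_nat_widenl _ _ _ predT) // -{1}[rank A y]add0n big_addn addKn.
by rewrite big_mkord; apply: eq_bigr => c _; rewrite addnC.
Qed.

End Rank.

(** * Enumerating the naturally ordered chain forests *)

Lemma perm_cons_rem (T : eqType) (z : T) (L A : seq T) :
  perm_eq (z :: L) A = (z \in A) && perm_eq L (rem z A).
Proof.
case zA: (z \in A) => /=.
  by rewrite (perm_sym _ A) (permPl (perm_to_rem zA)) perm_cons perm_sym.
by apply/negP => /perm_mem/(_ z); rewrite mem_head zA.
Qed.

(* In a completion [p] of a word whose current leader is [y], [p.1] is the rest of
   the current block, [p.2] is the list of the later blocks, and [A] is the list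
   of the unused elements. *)
Definition completion {s} (y : 'I_s) (A : seq 'I_s)
    (p : seq 'I_s * seq (seq 'I_s)) : bool :=
  [&& all (fun B => B != [::]) p.2, perm_eq (p.1 ++ flatten p.2) A
    & path ltn y (map (@leader s) p.2)].

(** The first list extends the current block by [z]; the second closes it and opens a block with
    leader [z], which natural order forces above [y]. The fuel [n] is meant to be [size A]. *)
Fixpoint completions {s} (n : nat) (y : 'I_s) (A : seq 'I_s) :
    seq (seq 'I_s * seq (seq 'I_s)) :=
  if n is n'.+1 then
    [seq (z :: p.1, p.2) | z <- A, p <- completions n' y (rem z A)]
    ++ [seq ([::], (z :: p.1) :: p.2) |
         z <- [seq z : 'I_s <- A | (y < z)%N], p <- completions n' z (rem z A)]
  else [:: ([::], [::])].

Section Completions.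
Variable s : nat.
Implicit Types (y z : 'I_s) (A B : seq 'I_s) (G : seq (seq 'I_s)).

Lemma completion_cons y A z B G :
  completion y A (z :: B, G) = (z \in A) && completion y (rem z A) (B, G).
Proof.
by rewrite /completion /= perm_cons_rem; case: (z \in A); rewrite ?andbF.
Qed.

Lemma completion_trailer y A z B G :
  completion y A ([::], (z :: B) :: G)
  = [&& z \in A, (y < z)%N & completion z (rem z A) (B, G)].
Proof.
rewrite /completion /= -cat_cons perm_cons_rem.
by case: (z \in A); case: (y < z)%N; rewrite ?andbF.
Qed.

Lemma mem_completions n y A p :
  size A = n -> (p \in completions n y A) = completion y A p.
Proof.
elim: n y A p => [|n IH] y A [B G].
  move=> /size0nil ->; rewrite inE /completion /=.
  case: B => [|z B]; last first.
    by rewrite andbA; case: permP => [/(_ predT)|]; rewrite ?andbF.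
  case: G => [//|[//|z B] G] /=.
  by rewrite andbA; case: permP => [/(_ predT)|]; rewrite ?andbF.
move=> szA; have szrem z : z \in A -> size (rem z A) = n.
  by move=> zA; rewrite size_rem // szA.
rewrite [completions _ _ _]/= mem_cat; case: B => [|z B].
  rewrite (_ : (_ \in _) = false) /=; last first.
    by apply/negP => /allpairsPdep[z [p []]].
  case: G => [|[|z B] G].
  - rewrite (_ : (_ \in _) = false) /=; last first.
      by apply/negP => /allpairsPdep[z [p []]].
    by apply/esym/negP; rewrite /completion /= => /andP[/perm_size]; rewrite szA.
  - by apply/negP => /allpairsPdep[z [p []]].
  rewrite completion_trailer; apply/allpairsPdep/and3P.
    case=> z' [[B' G'] [/=]]; rewrite mem_filter => /andP[y_z zA] p_in.
    by case=> -> -> ->; rewrite -(IH z') ?szrem.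
  case=> zA y_z p_in; exists z, (B, G).
  by rewrite mem_filter y_z zA IH ?szrem.
rewrite [X in _ || X](_ : _ = false) ?orbF; last first.
  by apply/negP => /allpairsPdep[z' [p []]].
rewrite completion_cons; apply/allpairsPdep/andP.
  by case=> z' [[B' G'] [/= zA p_in [-> -> ->]]]; rewrite -(IH y) ?szrem.
by case=> zA p_in; exists z, (B, G); rewrite IH ?szrem.
Qed.

Lemma uniq_completions n y A : uniq A -> uniq (completions n y A).
Proof.
elim: n y A => //= n IH y A uniqA; rewrite cat_uniq; apply/and3P; split.
- apply: allpairs_uniq_dep => // [z _|]; first by rewrite IH ?rem_uniq.
  by move=> [z [B G]] [z' [B' G']] _ _ /= [-> -> ->].
- apply/hasPn => p /allpairsPdep[z [q [_ _ ->]]].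
  by apply/negP => /allpairsPdep[z' [q' []]].
apply: allpairs_uniq_dep => [|z _|]; first by rewrite filter_uniq.
  by rewrite IH ?rem_uniq.
by move=> [z [B G]] [z' [B' G']] _ _ /= [-> -> ->].
Qed.

(** The first leader has no predecessor to exceed, so any element may open the word. *)
Definition chain_forests : seq (seq (seq 'I_s)) :=
  [seq (z :: p.1) :: p.2 |
    z <- enum 'I_s, p <- completions s.-1 z (rem z (enum 'I_s))].

Lemma uniq_chain_forests : uniq chain_forests.
Proof.
apply: allpairs_uniq_dep => [|z _|]; first exact: enum_uniq.
  by rewrite uniq_completions ?rem_uniq ?enum_uniq.
by move=> [z [B G]] [z' [B' G']] _ _ /= [-> -> ->].
Qed.

Lemma mem_chain_forests F : (0 < s)%N ->
  (F \in chain_forests) = chain_forest F && naturally_ordered F.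
Proof.
move=> s_gt0.
have mem_comp z p : (p \in completions s.-1 z (rem z (enum 'I_s)))
    = completion z (rem z (enum 'I_s)) p.
  by rewrite mem_completions // size_rem ?mem_enum // size_enum_ord.
case: F => [|[|z B] G].
- rewrite (_ : (_ \in _) = false); last first.
    by apply/negP => /allpairsPdep[z [p []]].
  rewrite /chain_forest; case: permP => [/(_ predT)|//].
  by rewrite !count_predT size_enum_ord /=; lia.
- by apply/negP => /allpairsPdep[z [p []]].
transitivity (completion z (rem z (enum 'I_s)) (B, G)).
  apply/allpairsPdep/idP.
    by case=> z' [[B' G'] [/= _ p_in [-> -> ->]]]; rewrite -mem_comp.
  by move=> p_in; exists z, (B, G); rewrite mem_enum mem_comp.
rewrite /completion /chain_forest /naturally_ordered /= -cat_cons.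
by rewrite perm_cons_rem mem_enum andbA.
Qed.

End Completions.

(** * Weighted sums over completions and forests *)

Section Weights.
Variables (s : nat) (R : comNzRingType).
Implicit Types (y z : 'I_s) (A B : seq 'I_s) (F G : seq (seq 'I_s)).

Fixpoint trailer_weight (x : nat -> R) F : R :=
  if F is B :: F' then x (size (flatten F')) * trailer_weight x F' else 1.

Variables (X : nat -> R) (t : R).
Let x r := (1 - t) * X r.

Definition forest_weight F := t ^+ weight F * trailer_weight x F.

(** The factor [t ^+ rank p.1 y] is only what the rest of the current block still adds to its
    weight; the elements already written are accounted for earlier. *)
Definition completion_weight y (p : seq 'I_s * seq (seq 'I_s)) : R :=
  t ^+ rank p.1 y * t ^+ weight p.2 * trailer_weight x (p.1 :: p.2).

Lemma block_weight_cons z B : block_weight (z :: B) = rank B z.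
Proof. by rewrite /block_weight /= ltnn. Qed.

Lemma completion_weight_cons y z p :
  completion_weight y (z :: p.1, p.2) = t ^+ (z < y)%N * completion_weight y p.
Proof. by rewrite /completion_weight /= exprD !mulrA. Qed.

Lemma completion_weight_trailer y z p :
  completion_weight y ([::], (z :: p.1) :: p.2)
  = x (size (p.1 ++ flatten p.2)).+1 * completion_weight z p.
Proof.
rewrite /completion_weight /= mul1r /weight big_cons block_weight_cons.
by rewrite exprD; ring.
Qed.

Lemma forest_weight_cons z p :
  forest_weight ((z :: p.1) :: p.2) = completion_weight z p.
Proof.
by rewrite /forest_weight /weight big_cons block_weight_cons exprD.
Qed.

Lemma sum_completions n y A : uniq A -> y \notin A -> size A = n ->
  \sum_(p <- completions n y A) completion_weight y p
  = state_weight X t (rank A y) (corank A y).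
Proof.
elim: n y A => [|n IH] y A uniqA yA szA.
  rewrite (size0nil szA) big_seq1 /completion_weight /weight /= big_nil.
  by rewrite state_weight00 !expr0 !mul1r mulr1.
have szrem z : z \in A -> size (rem z A) = n.
  by move=> zA; rewrite size_rem // szA.
have rank_y := rank_corank _ _ _ yA; rewrite szA in rank_y.
rewrite big_cat /= !big_allpairs_dep /= big_filter state_weightE ?rank_y //.
congr (_ + _).
  (* Extending the block by [z] uses up one element on the side of [y] where [z] lies, with a factor
     [t] when it is below. *)
  transitivity (\sum_(z <- A) t ^+ (z < y)%N *
     state_weight X t (rank A y - (z < y))%N (corank A y - (y < z))%N).
    apply: eq_big_seq => z zA.
    under eq_bigr => p _ do rewrite completion_weight_cons.
    rewrite -big_distrr /= IH ?rem_uniq ?szrem //; last first.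
      by apply: contraNN yA => /mem_rem.
    by rewrite rank_rem // corank_rem.
  rewrite (bigID (fun z : 'I_s => (z < y)%N)) /=; congr (_ + _).
    rewrite (eq_bigr (fun _ => t * state_weight X t (rank A y).-1 (corank A y))).
      by rewrite big_const_seq iter_addr_0 -[LHS]mulr_natl -[RHS]mulrA.
    by move=> z z_y; rewrite z_y subn1 ltnNge ltnW // subn0.
  rewrite big_seq_cond.
  rewrite (eq_big (fun z : 'I_s => (z \in A) && (y < z)%N)
            (fun _ => state_weight X t (rank A y) (corank A y).-1)).
  - by rewrite -big_seq_cond big_const_seq iter_addr_0 -[LHS]mulr_natl.
  - move=> z; case zA: (z \in A) => //=; rewrite -leqNgt leq_eqVlt.
    by case: eqP => // /val_inj yz; rewrite yz zA in yA.
  move=> z /andP[zA z_y]; rewrite (negPf z_y) subn0 mul1r.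
  move: z_y; rewrite -leqNgt leq_eqVlt => /predU1P[/val_inj yz|->].
    by rewrite yz zA in yA.
  by rewrite subn1.
transitivity (\sum_(z <- A | (y < z)%N)
    x n.+1 * state_weight X t (rank A z) (n - rank A z)%N).
  rewrite big_seq_cond [RHS]big_seq_cond; apply: eq_bigr => z /andP[zA _].
  rewrite (eq_big_seq (fun p => x n.+1 * completion_weight z p)); last first.
    move=> p; rewrite mem_completions ?szrem // => /and3P[_ /perm_size szp _].
    by rewrite completion_weight_trailer szp szrem.
  rewrite -big_distrr /= IH ?rem_uniq ?szrem ?mem_rem_uniq // ?inE ?eqxx //.
  congr (_ * state_weight _ _ _ _); first by rewrite rank_rem // ltnn subn0.
  have := @rank_corank _ (rem z A) z; rewrite mem_rem_uniq // inE eqxx => /(_ isT).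
  by rewrite szrem // rank_rem // ltnn subn0 => <-; rewrite addKn.
rewrite -big_distrr /= (sum_above_rank _ _ uniqA _
  (fun c => state_weight X t c (n - c)%N)) //; congr (_ * _).
apply: eq_bigr => c _; congr (state_weight _ _ _ _).
by have := ltn_ord c; lia.
Qed.

Lemma sum_chain_forests : (0 < s)%N ->
  \sum_(F <- chain_forests s) forest_weight F
  = \sum_(0 <= i < s.+1)
      'C(s, i)%:R * (- t) ^+ i
        * (X 0 * \prod_(1 <= j < s) (X j + j%:R - i%:R)).
Proof.
move=> s_gt0; have Ds : s = s.-1.+1 by lia.
rewrite big_allpairs_dep /=.
transitivity (\sum_(z <- enum 'I_s)
    state_weight X t (rank (enum 'I_s) z) (s.-1 - rank (enum 'I_s) z)%N).
  apply: eq_bigr => z _; have zI : z \in enum 'I_s by rewrite mem_enum.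
  under eq_bigr => p _ do rewrite forest_weight_cons.
  have z_rem : z \notin rem z (enum 'I_s).
    by rewrite mem_rem_uniq ?enum_uniq // inE eqxx.
  have sz_rem : size (rem z (enum 'I_s)) = s.-1 by rewrite size_rem // size_enum_ord.
  rewrite sum_completions ?rem_uniq ?enum_uniq //.
  rewrite -sz_rem -(rank_corank _ _ _ z_rem) !rank_rem // ltnn subn0.
  by rewrite addKn.
rewrite -(big_map (rank (enum 'I_s)) predT
  (fun c => state_weight X t c (s.-1 - c)%N)).
rewrite (perm_big _ (perm_map_rank _ _ (enum_uniq _))) /= size_enum_ord.
rewrite -{1}(subn0 s) -/(index_iota 0 s) big_mkord.
by move: (state_weight_total R X t s.-1); rewrite -Ds.
Qed.

End Weights.

(** * Extracting coefficients *)

Lemma PiE n a b N : b - a + 1 = N%:Z ->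
  Pi n a b = \sum_(J : {set 'I_N} | #|J|%:Z == n) \prod_(j in J) (a + j%:Z).
Proof.
move=> Dab; rewrite /Pi; have : absz (Num.max 0 (b - a + 1)) = N.
  by rewrite Dab max_r.
by move: (absz _) => K DK; rewrite DK.
Qed.

(** Expand the product: [J] is the set of factors contributing their constant, so degree [d] means
    [N - d] constants. For [d > N] both sides are 0. *)
Lemma coef_prod_XaddC (R : comNzRingType) (N d : nat) (a b : int) :
  b - a + 1 = N%:Z ->
  (\prod_(j < N) ('X + ((a + j%:Z)%:~R)%:P : {poly R}))`_d
  = (Pi (N%:Z - d%:Z) a b)%:~R.
Proof.
move=> /PiE ->.
under eq_bigr => j _ do rewrite addrC.
rewrite bigA_distr coef_sum.
rewrite rmorph_sum /= [RHS]big_mkcond /=; apply: eq_bigr => J _.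
rewrite (bigID (mem J)) /=.
rewrite (eq_bigr (fun j : 'I_N => ((a + j%:Z)%:~R)%:P)); last first.
  by move=> j ->.
rewrite [X in _ * X](eq_bigr (fun _ => 'X)); last by move=> j /negPf ->.
rewrite -rmorph_prod prodr_const coefCM coefXn -rmorph_prod /=.
have -> : #|[pred j | j \notin J]| = (N - #|J|)%N.
  by rewrite -[X in (X - _)%N](card_ord N) -(cardC (mem J)) addKn; apply: eq_card.
have leJ : (#|J| <= N)%N by have := max_card (mem J); rewrite card_ord.
have -> : (d == N - #|J|)%N = (#|J|%:Z == N%:Z - d%:Z) by lia.
by case: ifP; rewrite ?mulr1 ?mulr0.
Qed.

(** Division by a power of [1 - 'X] without power series: one factor is removed at a time, and
    Pascal's rule updates the coefficients. *)
Lemma coef_div_pow_1subX (k : nat) (P Q : {poly int}) (q : nat) :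
  (1 - 'X) ^+ k.+1 * P = Q ->
  P`_q = \sum_(0 <= i < q.+1) Q`_i * 'C(k + q - i, k)%:Z.
Proof.
have coef_1subX (p : {poly int}) j : ((1 - 'X) * p)`_j.+1 = p`_j.+1 - p`_j.
  by rewrite mulrBl mul1r coefB coefXM.
have coef_1subX0 (p : {poly int}) : ((1 - 'X) * p)`_0 = p`_0.
  by rewrite mulrBl mul1r coefB coefXM subr0.
elim: k P q => [|k IHk] P q DQ.
  under eq_bigr => i _ do rewrite bin0 mulr1.
  rewrite -{}DQ expr1; elim: q => [|q IHq].
    by rewrite big_nat1 coef_1subX0.
  by rewrite big_nat_recr //= -IHq coef_1subX addrC subrK.
have /IHk IH : (1 - 'X) ^+ k.+1 * ((1 - 'X) * P) = Q by rewrite mulrA -exprSr.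
elim: q => [|q IHq].
  have := IH 0%N; rewrite coef_1subX0 !big_nat1 => ->.
  by rewrite !addn0 !subn0 !binn.
have := IH q.+1; rewrite coef_1subX => /eqP; rewrite subr_eq => /eqP ->.
rewrite IHq !(big_nat_recr q.+1) //= addrAC -big_split /=.
congr (_ + _); last by rewrite !addnK !binn.
apply: eq_big_nat => i /andP[_ i_q].
rewrite -mulrDr -PoszD addSnnS; congr (_ * _%:Z).
have -> : (k + q.+1 - i = (k + q - i).+1)%N by lia.
have -> : (k.+1 + q.+1 - i = (k + q - i).+2)%N by lia.
by rewrite binS addnC.
Qed.

(** * Trailers and the statistic [gamma] *)

Section Gamma.
Variable s : nat.
Implicit Type F : seq (seq 'I_s).

Lemma trailer_weight_drop (R : comNzRingType) (x : nat -> R) F :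
  trailer_weight s R x F
  = \prod_(j <- iota 1 (size F)) x (size (flatten (drop j F))).
Proof.
elim: F => [|B F IH]; first by rewrite big_nil.
have -> : iota 1 (size (B :: F)) = 1%N :: map (addn 1) (iota 1 (size F)).
  by rewrite -iotaDl.
rewrite big_cons -[drop 1 _]/(drop 0 F) drop0 big_map /= IH.
by congr (_ * _); apply: eq_bigr => j _; rewrite add1n.
Qed.

Lemma gamma_size F l : (gamma F l <= size F)%N.
Proof. by rewrite (leq_trans (count_size _ _)) // size_iota. Qed.

(** A trailer is followed by fewer than [s - l] elements exactly when its position exceeds [l], that
    is, when [gamma] counts it. *)
Lemma trailer_weight_gamma (R : comNzRingType) (u v : R) (F : seq (seq 'I_s)) l :
  chain_forest F ->
  trailer_weight s R (fun r => if (r < s - l)%N then u else v) F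
  = u ^+ gamma F l * v ^+ (size F - gamma F l).
Proof.
case/andP=> _ /perm_size; rewrite size_enum_ord => szF.
rewrite trailer_weight_drop (bigID (fun j => l < \sum_(B <- take j F) size B)%N) /=.
have drop_lt j : (size (flatten (drop j F)) < s - l)%N
    = (l < \sum_(B <- take j F) size B)%N.
  have : (size (flatten (take j F)) + size (flatten (drop j F)) = s)%N.
    by rewrite -size_cat -flatten_cat cat_take_drop.
  by rewrite size_flatten /shape sumnE big_map; lia.
congr (_ * _).
  rewrite (eq_bigr (fun _ => u)); last by move=> j; rewrite drop_lt => ->.
  by rewrite big_const_seq iter_mulr_1.
rewrite (eq_bigr (fun _ => v)); last first.
  by move=> j /negPf; rewrite drop_lt => ->.
rewrite big_const_seq iter_mulr_1; congr (_ ^+ _).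
have := count_predC (fun j => (l < \sum_(B <- take j F) size B)%N) (iota 1 (size F)).
by rewrite /gamma size_iota => DF; rewrite -[X in _ = (X - _)%N]DF addKn.
Qed.

End Gamma.

(** * From the finite set [CF] to the enumeration *)

Lemma blocks_inj s : injective (@blocks s).
Proof. by move=> F G /(inj_map val_inj) /val_inj. Qed.

Lemma blocks_surj s (F : seq (seq 'I_s)) :
  chain_forest F -> exists G : s.-bseq (s.-bseq 'I_s), blocks G = F.
Proof.
case/andP=> F_ne /perm_size; rewrite size_enum_ord => szF.
have le_block B : B \in F -> (size B <= s)%N.
  move=> BF; apply: leq_trans (eq_leq szF).
  by case/path.splitPr: BF => F1 F2; rewrite flatten_cat size_cat /= size_cat; lia.
have leF : (size F <= s)%N.
  apply: leq_trans (eq_leq szF); elim: F F_ne {szF le_block} => //= B F IH.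
  by case/andP; case: B => // z B _ /IH; rewrite /= size_cat; lia.
have szG : (size (map (@insub_bseq s 'I_s) F) <= s)%N by rewrite size_map.
exists (Bseq szG); rewrite /blocks /= -map_comp -[RHS]map_id.
by apply/eq_in_map => B /le_block leB /=; rewrite /insub_bseq insubdK.
Qed.

Lemma card_CF q s k l m : (0 < s)%N ->
  #|CF q s k l m| = count (fun F => [&& size F == k, weight F == q
    & gamma F l == m]) (chain_forests s).
Proof.
move=> s_gt0; rewrite -size_filter cardE -(size_map (@blocks s)).
apply/perm_size/uniq_perm.
- by rewrite map_inj_uniq ?enum_uniq //; apply: blocks_inj.
- by rewrite filter_uniq // uniq_chain_forests.
move=> F; rewrite mem_filter mem_chain_forests //; apply/mapP/idP.
  case=> G; rewrite mem_enum inE => /and5P[cG nG szG wG gG] ->.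
  by rewrite cG nG szG wG gG.
case/andP=> /and3P[szF wF gF] /andP[cF nF].
have [G DG] := blocks_surj _ _ cF.
by exists G; rewrite // mem_enum inE DG cF nF szF wF gF.
Qed.

(** * The generating function in [t], [U] and [V] *)

Section GeneratingFunction.
Variables (s l : nat) (R : comNzRingType) (t U V : R).
Hypothesis lt_ls : (l < s)%N.

Let X r : R := if (r < s - l)%N then U else V.

Lemma forest_weight_gamma F : chain_forest F ->
  forest_weight s R X t F
  = t ^+ weight F * (1 - t) ^+ size F * (U ^+ gamma F l * V ^+ (size F - gamma F l)).
Proof.
move=> cF; rewrite /forest_weight.
have -> : trailer_weight s R (fun r => (1 - t) * X r) F
    = ((1 - t) * U) ^+ gamma F l * ((1 - t) * V) ^+ (size F - gamma F l).
  rewrite -trailer_weight_gamma // !trailer_weight_drop.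
  by apply: eq_bigr => j _; rewrite /X; case: ifP.
by rewrite !exprMn mulrACA -exprD subnKC ?gamma_size // !mulrA.
Qed.

Lemma sum_forests_gamma :
  \sum_(F <- chain_forests s)
    t ^+ weight F * (1 - t) ^+ size F * (U ^+ gamma F l * V ^+ (size F - gamma F l))
  = \sum_(0 <= i < s.+1) 'C(s, i)%:R * (- t) ^+ i
      * (U * (\prod_(j < s - l.+1) (U + (- i%:Z + 1 + j%:Z)%:~R)
              * \prod_(j < l) (V + (s%:Z - l%:Z - i%:Z + j%:Z)%:~R))).
Proof.
have s_gt0 : (0 < s)%N by lia.
transitivity (\sum_(F <- chain_forests s) forest_weight s R X t F).
  apply: eq_big_seq => F; rewrite mem_chain_forests // => /andP[cF _].
  by rewrite forest_weight_gamma.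
rewrite sum_chain_forests //; apply: eq_bigr => i _; congr (_ * (_ * _)).
  by rewrite /X subn_gt0 lt_ls.
(* [X] switches from [U] to [V] at [s - l]: the first [s - l.+1] factors contain [U], the last [l]
   contain [V]. *)
rewrite (@big_cat_nat _ _ _ (s - l)%N) //=; [|lia..].
congr (_ * _).
  rewrite big_add1 -subnS big_mkord; apply: eq_bigr => j _.
  have -> : X j.+1 = U by rewrite /X; case: ifP => //; have := ltn_ord j; lia.
  by rewrite -addrA; congr (_ + _); rewrite !rmorphD /= rmorphN /=; ring.
rewrite -{1}[(s - l)%N]add0n big_addn subKn ?(ltnW lt_ls) // big_mkord.
apply: eq_bigr => j _.
have -> : X (j + (s - l))%N = V by rewrite /X ltnNge leq_addl.
rewrite -addrA; congr (_ + _).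
by rewrite natrD natrB ?(ltnW lt_ls) // !rmorphD /= !rmorphN /=; ring.
Qed.

End GeneratingFunction.

Lemma coef_monomial2 (A : comNzRingType) (c : A) a b m n :
  (c%:P%:P * ('X^a * ('X)%:P ^+ b) : {poly {poly A}})`_m`_n
  = c *+ ((m == a) && (n == b)).
Proof.
rewrite coefCM -rmorphXn coefMC coefXn.
case: eqP => _; last by rewrite mul0r mulr0 coef0.
by rewrite mul1r coefCM coefXn; case: eqP => _; rewrite ?mulr1 ?mulr0.
Qed.

Lemma coef_product2 (A : comNzRingType) (c : A) (P : {poly {poly A}}) (Q : {poly A})
    (x y : int) m n :
  P`_m = x%:~R -> Q`_n = y%:~R ->
  (c%:P%:P * ('X * (P * Q%:P)))`_m.+1`_n = c * x%:~R * y%:~R.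
Proof.
move=> Px Qy; rewrite coefCM coefXM /= coefMC Px coefCM.
by rewrite -(rmorph_int (@polyC A)) coefCM Qy mulrA.
Qed.

Lemma polyCC_monomial (A : comNzRingType) (p : A) a b :
  p%:P%:P ^+ a * (1 - p%:P%:P) ^+ b = (p ^+ a * (1 - p) ^+ b)%:P%:P
  :> {poly {poly A}}.
Proof. by rewrite !polyCM !polyC_exp !polyCB. Qed.

Lemma forest_gf s k l m : (m < k)%N -> (l < s)%N ->
  (1 - 'X) ^+ k
    * \sum_(F <- chain_forests s | (size F == k) && (gamma F l == m.+1)) 'X^(weight F)
  = \sum_(0 <= i < s.+1)
      ('C(s, i)%:Z * (-1) ^+ i
        * Pi (s%:Z - l%:Z - m.+1%:Z) (- i%:Z + 1) (s%:Z - 1 - l%:Z - i%:Z)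
        * Pi (l%:Z - (k%:Z - m.+1%:Z)) (s%:Z - l%:Z - i%:Z) (s%:Z - 1 - i%:Z))
      *: 'X^i :> {poly int}.
Proof.
move=> lt_mk lt_ls.
(* The three variables are nested polynomial variables, [U] outermost, then [V], then [t]; the
   coefficient of [U^(m+1) V^(k-m-1)] is then taken. *)
have := sum_forests_gamma s l {poly {poly {poly int}}}
  ('X)%:P%:P 'X ('X)%:P lt_ls.
move=> /(congr1 (fun p : {poly {poly {poly int}}} => p`_m.+1`_(k - m.+1))).
cbv beta; rewrite !coef_sum => gf.
rewrite big_distrr /= big_mkcond /=; symmetry.
transitivity (\sum_(0 <= i < s.+1) ('C(s, i)%:R * (- 'X : {poly int}) ^+ i)
   * (Pi (s%:Z - l%:Z - m.+1%:Z) (- i%:Z + 1) (s%:Z - 1 - l%:Z - i%:Z))%:~R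
   * (Pi (l%:Z - (k%:Z - m.+1%:Z)) (s%:Z - l%:Z - i%:Z) (s%:Z - 1 - i%:Z))%:~R).
  apply: eq_bigr => i _.
  rewrite -mul_polyC !rmorphM /= rmorphXn rmorphN1 [(- 'X) ^+ i]exprNn.
  by rewrite -!(rmorph_int (@polyC _)) !intz; ring.
transitivity (\sum_(0 <= i < s.+1)
  ('C(s, i)%:R * (- ('X)%:P%:P) ^+ i
     * ('X * (\prod_(j < s - l.+1) ('X + (- i%:Z + 1 + j%:Z)%:~R)
        * \prod_(j < l) (('X)%:P + (s%:Z - l%:Z - i%:Z + j%:Z)%:~R)))
     : {poly {poly {poly int}}})`_m.+1`_(k - m.+1)).
  apply: eq_bigr => i _; symmetry.
  have -> : 'C(s, i)%:R * (- ('X)%:P%:P) ^+ i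
     = ('C(s, i)%:R * (- 'X) ^+ i)%:P%:P :> {poly {poly {poly int}}}.
    by rewrite !polyCM !rmorphXn /= !polyCN !rmorph_nat.
  have -> : \prod_(j < l) (('X)%:P + (s%:Z - l%:Z - i%:Z + j%:Z)%:~R)
     = (\prod_(j < l) ('X + ((s%:Z - l%:Z - i%:Z + j%:Z)%:~R)%:P))%:P
     :> {poly {poly {poly int}}}.
    rewrite rmorph_prod; apply: eq_bigr => j _.
    by rewrite /= polyCD !rmorph_int.
  (* The factor [U] coming from [X 0] takes one power, so degree [m] is read off the first product,
     of [s - l - 1] factors, and degree [k - m.+1] off the second, of [l] factors. *)
  apply: coef_product2.
    under eq_bigr => j _ do rewrite -(rmorph_int (@polyC _)).
    by rewrite (coef_prod_XaddC _ _ _ _ (s%:Z - 1 - l%:Z - i%:Z)); last lia;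
      congr (Pi _ _ _)%:~R; lia.
  by rewrite (coef_prod_XaddC _ _ _ _ (s%:Z - 1 - i%:Z)); last lia;
    congr (Pi _ _ _)%:~R; lia.
rewrite -{}gf; apply: eq_big_seq => F; rewrite mem_chain_forests; last lia.
move=> /andP[cF _].
rewrite polyCC_monomial.
rewrite coef_monomial2.
(* Since [gamma F l <= size F] and [m < k], neither subtraction truncates, so the two exponents
   determine [size F]. *)
have -> : (m.+1 == gamma F l) && (k - m.+1 == size F - gamma F l)%N
   = (size F == k) && (gamma F l == m.+1).
  have := gamma_size _ F l; move: (gamma F l) (size F) => g n le_gn.
  by apply/andP/andP => -[/eqP ? /eqP ?]; split; apply/eqP; lia.
by case: andP => // -[/eqP <- _]; rewrite mulr1n mulrC.
Qed.

(** * The counting formula *)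

Theorem mainTheorem1 (q s k l m : nat)
    (hm : (1 <= m)%N) (hmk : (m <= k)%N) (hks : (k <= s)%N)
    (hl : (l <= s - 1)%N) :
  #|CF q s k l m|%:Z =
  \sum_(0 <= i < q.+1)
    (-1) ^+ i * 'C(s, i)%:Z
    * Pi (s%:Z - l%:Z - m%:Z) (- i%:Z + 1) (s%:Z - 1 - l%:Z - i%:Z)
    * Pi (l%:Z - (k%:Z - m%:Z)) (s%:Z - l%:Z - i%:Z) (s%:Z - 1 - i%:Z)
    * 'C(k - 1 + q - i, k - 1)%:Z.
Proof.
have lt_ls : (l < s)%N by lia.
case: m hm hmk => // m _ lt_mk.
case: k lt_mk hks => // k lt_mk _.
rewrite card_CF; last lia.
have /(coef_div_pow_1subX k _ _ q) gf := forest_gf s k.+1 l m lt_mk lt_ls.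
transitivity ((\sum_(F <- chain_forests s | (size F == k.+1) && (gamma F l == m.+1))
  'X^(weight F) : {poly int})`_q).
  rewrite coef_sum -sum1_count -natz natr_sum big_mkcond [RHS]big_mkcond.
  apply: eq_bigr => F _; rewrite coefXn [q == _]eq_sym.
  by case: (size F == _); case: (weight F == _); case: (gamma F l == _).
rewrite {}gf subn1 /=; apply: eq_bigr => i _; congr (_ * _).
rewrite coef_sum big_mkord.
under eq_bigr => j _ do rewrite coefZ coefXn.
(* The generating function stops at degree [s], while [i] runs up to [q]; beyond [s] the binomial
   ['C(s, i)] is 0. *)
have [le_is|lt_si] := leqP i s.
  rewrite (bigD1 (Ordinal (le_is : (i < s.+1)%N))) //= eqxx mulr1.
  rewrite big1 ?addr0; first by rewrite [_ * (-1) ^+ i]mulrC.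
  by move=> j /negPf; rewrite -val_eqE eq_sym /= => ->; rewrite mulr0.
rewrite bin_small // mulr0 !mul0r big1 // => j _.
by have := ltn_ord j; case: eqP => [<-|_ _]; rewrite ?mulr0 //; lia.
Qed.
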